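(* Let $d \geq 2$ be an integer and let $\mathcal{G}$ be a hereditary graph class with $d$-dominated balanced separators. Then, for every integer $\ell \geq 2$, every $K_{2,\ell}$-free graph $G\in\mathcal{G}$ with $n \geq 2$ vertices has a vertex $v$ such that $\alpha(G[N[v]]) \leq d\ell \log_2 n$.
   Context: Graphs are finite and simple. A graph class is hereditary if it is closed under taking induced subgraphs. A hereditary class $\mathcal{G}$ has $d$-dominated balanced separators if every graph $G\in\mathcal{G}$ contains a set $X\subseteq V(G)$ with $|X|\le d$ such that every connected component of $G-N[X]$ has at most $\frac12|V(G)|$ vertices, where $N[X]$ is the union of the closed neighborhoods of vertices of $X$. $K_{2,\ell}$ is the complete bipartite graph with parts of sizes $2$ and $\ell$; $K_{2,\ell}$-free means no induced subgraph isomorphic to $K_{2,\ell}$. $N[v]$ is the closed neighborhood of $v$ and $\alpha$ the independence number. *)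

(* Defs.v *)
From mathcomp Require Import all_boot all_order all_algebra.
From mathcomp Require Import reals exp.

Set Implicit Arguments.
Unset Strict Implicit.
Unset Printing Implicit Defensive.

Import Order.TTheory GRing.Theory Num.Theory.

Record sgraph := SGraph {
  vertex :> finType;
  edge : rel vertex;
  edge_sym : symmetric edge;
  edge_irrefl : irreflexive edge }.

Arguments edge {s} _ _.

Definition isomorphic (G H : sgraph) : Prop :=
  exists2 f : G -> H, bijective f & forall x y, edge (f x) (f y) = edge x y.

Section Induced.
Variables (G : sgraph) (S : {set G}).

Let induced_edge : rel {x : G | x \in S} := fun x y => edge (val x) (val y).

Fact induced_edge_sym : symmetric induced_edge.
Proof. by move=> x y; apply: edge_sym. Qed.

Fact induced_edge_irrefl : irreflexive induced_edge.
Proof. by move=> x; apply: edge_irrefl. Qed.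

Definition induced : sgraph := SGraph induced_edge_sym induced_edge_irrefl.

End Induced.

Definition induced_subgraph (H G : sgraph) : Prop :=
  exists S : {set G}, isomorphic H (induced S).

Definition induced_free (H G : sgraph) : Prop := ~ induced_subgraph H G.

Section CompleteBipartite.
Variables m n : nat.

Let Kmn_edge : rel ('I_m + 'I_n)%type := fun x y =>
  match x, y with
  | inl _, inr _ | inr _, inl _ => true
  | _, _ => false
  end.

Fact Kmn_edge_sym : symmetric Kmn_edge.
Proof. by case=> [i|i] [j|j]. Qed.

Fact Kmn_edge_irrefl : irreflexive Kmn_edge.
Proof. by case. Qed.

Definition complete_bipartite : sgraph := SGraph Kmn_edge_sym Kmn_edge_irrefl.

End CompleteBipartite.

Section Invariants.
Variable G : sgraph.

Definition closed_nbhd (v : G) : {set G} := [set u | (u == v) || edge v u].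

Definition closed_nbhds (X : {set G}) : {set G} :=
  \bigcup_(x in X) closed_nbhd x.

Definition component (x : G) : {set G} := [set y | connect edge x y].

Definition components : {set {set G}} := [set component x | x : G].

Definition independent (S : {set G}) : bool :=
  [forall x in S, forall y in S, ~~ edge x y].

Definition independence_number : nat :=
  \max_(S : {set G} | independent S) #|S|.

End Invariants.

Definition dominated_balanced_separator (G : sgraph) (X : {set G}) : Prop :=
  forall C : {set induced (~: closed_nbhds X)},
    C \in components (induced (~: closed_nbhds X)) -> 2 * #|C| <= #|G|.

Definition graph_class := sgraph -> Prop.

(* [induced_subgraph] is taken up to isomorphism, so a hereditary class is in
   particular closed under isomorphism. *)
Definition hereditary (GG : graph_class) : Prop :=
  forall G H : sgraph, GG G -> induced_subgraph H G -> GG H.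

Definition has_dominated_balanced_separators (d : nat) (GG : graph_class) :
    Prop :=
  forall G : sgraph, GG G ->
    exists2 X : {set G}, #|X| <= d & dominated_balanced_separator X.

Definition log2 (R : realType) (x : R) : R := (ln x / ln 2)%R.

(* Main.v *)
(* Write [k = l - 1].  If [v] is outside [N[x]], then [N[v]] and [N[x]] meet in
   common neighbours of two non-adjacent vertices, so an independent subset of
   [N[v]] has at most [k] vertices in [N[x]].  Starting from [U = V(G)], shrink
   [U] repeatedly.  A vertex adjacent to all of [U] can be deleted for free, as
   it lies in no independent subset of [U] of size [2].  Otherwise let [X] be
   a separator of [G[U]].  If [U] is not inside [N[X]], pass to a component of
   [G[U] - N[X]]: this halves [U] and costs [d k].  If [U] is inside [N[X]],
   some [x] in [X] has [|U :&: N[x]| >= |U| / d], and passing to the nonempty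
   set [U - N[x]] costs only [k] and multiplies [|U|] by at most [1 - 1/d],
   whose [d]-th power is at most [1/2].  Either way a cost of [k] per halving
   of [|U|^d] leads to a total of [1 + d k log2 n]. *)
Require Import Defs.
From mathcomp Require Import all_boot all_order all_algebra.
From mathcomp Require Import reals exp.
From mathcomp Require Import zify.

Set Implicit Arguments.
Unset Strict Implicit.
Unset Printing Implicit Defensive.

(** * Unions, independent sets and induced subgraphs *)

Lemma leq_card_bigcup (I : Type) (T : finType) (r : seq I) (P : pred I)
    (F : I -> {set T}) :
  #|\bigcup_(i <- r | P i) F i| <= \sum_(i <- r | P i) #|F i|.
Proof.
elim/big_rec2: _ => [|i n A _ IH]; first by rewrite cards0.
by apply: leq_trans (leq_card_setU _ _) _; rewrite leq_add2l.
Qed.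

Lemma independentP (G : sgraph) (S : {set G}) :
  reflect {in S &, forall x y, ~~ edge x y} (independent S).
Proof.
apply: (iffP forall_inP) => [H x y xS yS|H x xS].
  exact: (forall_inP (H x xS)).
by apply/forall_inP => y; apply: H.
Qed.

Lemma independentS (G : sgraph) (S T : {set G}) :
  S \subset T -> independent T -> independent S.
Proof.
move=> /subsetP sST /independentP H; apply/independentP => x y xS yS.
by apply: H; apply: sST.
Qed.

Lemma independent_imset_val (G : sgraph) (U : {set G}) (S : {set induced U}) :
  independent S -> independent ([set val x | x in S] : {set G}).
Proof.
move=> /independentP H; apply/independentP.
by move=> _ _ /imsetP[x xS ->] /imsetP[y yS ->]; apply: (H x y).
Qed.

Lemma closed_nbhdC (G : sgraph) (x y : G) :
  (x \in closed_nbhd y) = (y \in closed_nbhd x).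
Proof. by rewrite !inE eq_sym edge_sym. Qed.

Lemma induced_subgraph_embedding (H G : sgraph) (f : H -> G) :
  injective f -> (forall x y, edge (f x) (f y) = edge x y) ->
  induced_subgraph H G.
Proof.
move=> f_inj f_edge; exists (f @: [set: H]).
have fP x : f x \in f @: [set: H] by apply: imset_f.
pose g x : induced (f @: [set: H]) := Sub (f x) (fP x).
have g_inj : injective g by move=> x y [/f_inj].
exists g => [|x y]; last by rewrite -f_edge.
apply: (inj_card_bij g_inj).
by rewrite card_sig (card_imset _ f_inj) cardsT.
Qed.

Lemma induced_subgraph_induced (G : sgraph) (U : {set G}) :
  induced_subgraph (induced U) G.
Proof.
pose f (x : induced U) : G := val x.
by apply: (@induced_subgraph_embedding _ _ f) => //; apply: val_inj.
Qed.

(** Any [l] vertices of [S], opposite the distinct non-adjacent pair [v], [x], would induce a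
    [K_{2,l}]. *)
Lemma card_common_nbrs (G : sgraph) (l : nat) (v x : G) (S : {set G}) :
  induced_free (complete_bipartite 2 l) G -> v \notin closed_nbhd x ->
  independent S -> {in S, forall u, edge v u && edge x u} -> #|S| < l.
Proof.
move=> hfree vx /independentP indS HS; rewrite ltnNge; apply/negP => lS.
apply: hfree.
pose s (j : 'I_l) := enum_val (widen_ord lS j).
have sS j : s j \in S by apply: enum_valP.
pose c (i : 'I_2) := if i == ord0 then v else x.
pose f (z : complete_bipartite 2 l) : G :=
  match z with inl i => c i | inr j => s j end.
move: vx; rewrite inE negb_or => /andP[vx evx].
have cs i j : edge (c i) (s j).
  by rewrite /c; have /andP[] := HS _ (sS j); case: ifP.
have c_inj : injective c.
  case=> [[|[|//]] ?] [[|[|//]] ?]; rewrite /c /= => E; apply: val_inj => //=.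
    by rewrite E eqxx in vx.
  by rewrite E eqxx in vx.
apply: (@induced_subgraph_embedding _ _ f).
  move=> [i|j] [i'|j'] //= E.
  - by rewrite (c_inj _ _ E).
  - by have := cs i j'; rewrite E edge_irrefl.
  - by have := cs i' j; rewrite E edge_irrefl.
  - by congr inr; apply/val_inj; have /(congr1 val) := enum_val_inj E.
move=> [i|j] [i'|j'] /=.
- rewrite /c; case: ifP => _; case: ifP => _; rewrite ?edge_irrefl //.
  + by rewrite edge_sym (negbTE evx).
  + exact: negbTE.
- exact: cs.
- by rewrite edge_sym; exact: cs.
- exact/negbTE/indS.
Qed.

(** Each [x] in [X] accounts for at most [l.-1] vertices of [S]; this is the price of discarding
    [closed_nbhds X]. *)
Lemma card_independent_cover (G : sgraph) (l : nat) (v : G)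
    (W X S : {set G}) :
  induced_free (complete_bipartite 2 l) G -> independent S ->
  S \subset closed_nbhd v -> v \notin closed_nbhds X ->
  S \subset W :|: closed_nbhds X ->
  #|S| <= #|S :&: W| + #|X| * l.-1.
Proof.
move=> hfree indS Sv vX SWX.
have sub : S \subset (S :&: W) :|: \bigcup_(x in X) (S :&: closed_nbhd x).
  apply/subsetP => u uS; have := subsetP SWX u uS.
  rewrite !in_setU in_setI uS /= => /orP[->//|/bigcupP[x xX ux]].
  by apply/orP; right; apply/bigcupP; exists x; rewrite // in_setI uS.
apply: leq_trans (subset_leq_card sub) _.
apply: leq_trans (leq_card_setU _ _) _; rewrite leq_add2l.
apply: leq_trans (leq_card_bigcup _ _ _) _.
rewrite -sum_nat_const; apply: leq_sum => x xX.
have vx : v \notin closed_nbhd x.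
  by apply: contra vX => vx; apply/bigcupP; exists x.
suff: #|S :&: closed_nbhd x| < l by lia.
apply: (card_common_nbrs hfree vx); first exact: independentS (subsetIl _ _) indS.
move=> u /setIP[uS ux]; have uv := subsetP Sv u uS.
(* A vertex of [N[v]] and [N[x]] equal to [v] or [x] would put [v] in [N[x]]; hence it is a genuine
   common neighbour. *)
have nuv : u != v by apply: contraNneq vx => <-.
have nux : u != x by apply: contraNneq vx => <-; rewrite closed_nbhdC.
by move: uv ux; rewrite !inE (negbTE nuv) (negbTE nux) /= => -> ->.
Qed.

(** * Separators of vertex subsets *)

(** Heredity gives a separator of [induced U]; it is transported to [G], so that the induction can
    work with subsets of one fixed graph. [W] is a component left after deleting [closed_nbhds X]
    from [U]. *)
Lemma separator_subset (d : nat) (GG : graph_class) (G : sgraph) (U : {set G}) :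
  hereditary GG -> has_dominated_balanced_separators d GG -> GG G ->
  exists X : {set G}, [/\ X \subset U, #|X| <= d &
    U \subset closed_nbhds X \/
    exists W : {set G}, [/\ W != set0, W \subset U :\: closed_nbhds X,
      2 * #|W| <= #|U| &
      {in W, forall v, U :&: closed_nbhd v \subset W :|: closed_nbhds X}]].
Proof.
move=> hher hsep hG.
have [X leX sepX] := hsep _ (hher _ _ hG (induced_subgraph_induced U)).
pose valX : {set G} := [set val x | x in X].
(* On vertices of [U], domination by [X] means the same in [induced U] as in [G]. *)
have valXP (u : induced U) :
    (val u \in closed_nbhds valX) = (u \in closed_nbhds X).
  apply/bigcupP/bigcupP => [[_ /imsetP[x xX ->]] ux|[x xX ux]].
    by exists x => //; move: ux; rewrite !inE.
  by exists (val x); [apply: imset_f | move: ux; rewrite !inE].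
exists valX; split.
- by apply/subsetP => _ /imsetP[x _ ->]; apply: valP.
- by rewrite (card_imset _ val_inj).
have [|/subsetPn[y yU yX]] := boolP (U \subset closed_nbhds valX); first by left.
right.
pose y1 : induced U := Sub y yU.
have y1P : y1 \in ~: closed_nbhds X by rewrite in_setC -valXP.
pose y2 : induced (~: closed_nbhds X) := Sub y1 y1P.
pose f (z : induced (~: closed_nbhds X)) : G := val (val z).
have f_inj : injective f by move=> a b /val_inj/val_inj.
exists (f @: component y2); split.
- by apply/set0Pn; exists (f y2); apply: imset_f; rewrite inE connect0.
- apply/subsetP => _ /imsetP[z _ ->]; rewrite in_setD; apply/andP; split.
    by rewrite valXP -in_setC; apply: valP.
  exact: (valP (val z)).
- rewrite (card_imset _ f_inj) -[X in _ <= X]card_sig.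
  by apply: sepX; apply: imset_f.
(* A neighbour in [U] of a component vertex is either dominated by the separator or in the same
   component. *)
move=> _ /imsetP[z zC ->]; apply/subsetP => u /setIP[uU uz].
rewrite in_setU.
have [|uX] := boolP (u \in closed_nbhds valX); first by rewrite orbT.
rewrite orbF.
pose u1 : induced U := Sub u uU.
have u1P : u1 \in ~: closed_nbhds X by rewrite in_setC -valXP.
pose u2 : induced (~: closed_nbhds X) := Sub u1 u1P.
rewrite -[u]/(f u2); apply: imset_f.
move: uz; rewrite inE => /orP[/eqP E|E].
  by have -> : u2 = z by apply: f_inj.
rewrite !inE in zC *; apply: connect_trans zC _.
exact: connect1.
Qed.

(** Bernoulli's inequality in homogeneous form: [(a + b) ^ d] is at least
    [a ^ d + d * b * a ^ d.-1], and [a <= d * b] makes the second term at least [a ^ d]. *)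
Lemma leq_double_expn (a b d : nat) : 0 < d -> a <= d * b -> 2 * a ^ d <= (a + b) ^ d.
Proof.
case: d => // e _ ab.
have bern k : a ^ k.+1 + k.+1 * b * a ^ k <= (a + b) ^ k.+1.
  elim: k => [|k IH]; first by rewrite !expn1 expn0; lia.
  rewrite [(a + b) ^ _]expnS; apply: leq_trans (leq_mul (leqnn _) IH).
  rewrite 2!(expnS a); move: (a ^ k) => t; nia.
apply: leq_trans (bern e); rewrite expnS; move: (a ^ e) ab => t ab; nia.
Qed.

(** Averaging: if every [x] failed, summing over [X] would give [d * #|U| <= d * #|U|.-1],
    impossible for nonempty [U]. *)
Lemma big_closed_nbhd (G : sgraph) (d : nat) (U X : {set G}) :
  0 < d -> 0 < #|U| -> #|X| <= d -> U \subset closed_nbhds X ->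
  exists2 x, x \in X & #|U| <= d * #|U :&: closed_nbhd x|.
Proof.
move=> d0 U0 leX UX; apply/exists_inP; apply: contraLR U0 => /exists_inPn H.
rewrite -eqn0Ngt.
have: d * #|U| <= \sum_(x in X) d * #|U :&: closed_nbhd x|.
  rewrite -big_distrr leq_mul2l /=; apply/orP; right.
  have -> : #|U| = #|\bigcup_(x in X) (U :&: closed_nbhd x)|.
    by rewrite -big_distrr /= (setIidPl UX).
  by apply: leq_trans (leq_card_bigcup _ _ _).
have : \sum_(x in X) d * #|U :&: closed_nbhd x| <= \sum_(x in X) #|U|.-1.
  by apply: leq_sum => x /H; lia.
rewrite sum_nat_const => h1 h2.
have : #|X| * #|U|.-1 <= d * #|U|.-1 by rewrite leq_mul2r leX orbT.
by move: d0 h1 h2; case: #|U| => // u; lia.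
Qed.

(** Strong induction on [#|U|]. Here [m] counts the units [l.-1] paid so far, each charged to one
    halving of [#|U| ^ d]. *)
Lemma exists_small_nbhd (d l : nat) (GG : graph_class) (G : sgraph) :
  0 < d -> hereditary GG -> has_dominated_balanced_separators d GG -> GG G ->
  induced_free (complete_bipartite 2 l) G ->
  forall U : {set G}, U != set0 ->
  exists v m, [/\ v \in U, 2 ^ m <= #|U| ^ d &
    forall S : {set G}, independent S -> S \subset U :&: closed_nbhd v ->
      #|S| <= 1 + m * l.-1].
Proof.
move=> d0 hher hsep hG hfree U; have [n] := ubnP #|U|.
elim: n U => // n IH U ltn U0.
have cU0 : 0 < #|U| by rewrite card_gt0.
have [/exists_inP[u uU Uu]|/exists_inPn nouniv] :=
  boolP [exists u in U, U \subset closed_nbhd u].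
  (* As [u] dominates [U], the sets [S] containing [u] are singletons; the others lie in [U :\ u],
     where induction applies at no cost. *)
  have indu S : independent S -> S \subset U -> u \in S -> #|S| <= 1.
    move=> /independentP indS SU uS; rewrite -(cards1 u); apply: subset_leq_card.
    apply/subsetP => w wS; rewrite in_set1.
    have := subsetP Uu w (subsetP SU w wS).
    by rewrite inE (negbTE (indS _ _ uS wS)) orbF.
  have cUu := cardsD1 u U; rewrite uU in cUu.
  have [E|Du0] := eqVneq (U :\ u) set0.
    exists u, 0; split=> // [|S indS]; first by rewrite expn_gt0 cU0.
    rewrite subsetI => /andP[SU _]; have := subset_leq_card SU.
    by rewrite cUu E cards0; lia.
  have [|v [m [vU hm HS]]] := IH (U :\ u) _ Du0; first by lia.
  exists v, m; split=> [||S indS].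
  - by move: vU; rewrite in_setD1 => /andP[].
  - by apply: leq_trans hm _; rewrite leq_exp2r //; lia.
  rewrite subsetI => /andP[SU Sv]; have [uS|uS] := boolP (u \in S).
    exact: leq_trans (indu S indS SU uS) (leq_addr _ _).
  by apply: HS => //; rewrite subsetI subsetD1 SU uS.
(* The number [k] has two roles: it bounds the vertices of [Y], each costing [l.-1], and it counts
   the halvings of [#|U| ^ d] gained by passing to [W]. *)
have step (W Y : {set G}) k : W != set0 -> #|W| < #|U| ->
    W \subset U :\: closed_nbhds Y -> #|Y| <= k ->
    {in W, forall v, U :&: closed_nbhd v \subset W :|: closed_nbhds Y} ->
    2 ^ k * #|W| ^ d <= #|U| ^ d ->
  exists v m, [/\ v \in U, 2 ^ m <= #|U| ^ d &
    forall S : {set G}, independent S -> S \subset U :&: closed_nbhd v ->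
      #|S| <= 1 + m * l.-1].
  move=> W0 ltW WUY leY HW hk.
  have [|v [m [vW hm HS]]] := IH W _ W0; first by lia.
  exists v, (k + m).
  have := subsetP WUY v vW; rewrite in_setD => /andP[vY vU].
  split=> // [|S indS SUv].
    by rewrite expnD; apply: leq_trans hk; rewrite leq_mul2l hm orbT.
  have Sv : S \subset closed_nbhd v by apply: subset_trans SUv (subsetIr _ _).
  apply: leq_trans (card_independent_cover hfree indS Sv vY _) _.
    exact: subset_trans SUv (HW v vW).
  have := HS (S :&: W) (independentS (subsetIl _ _) indS).
  rewrite subsetI subsetIr (subset_trans (subsetIl _ _) Sv) => /(_ isT) h.
  have : #|Y| * l.-1 <= k * l.-1 by rewrite leq_mul2r leY orbT.
  rewrite mulnDl; lia.
have [X [XU leX [UX|[W [W0 WUX leW HW]]]]] := separator_subset U hher hsep hG.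
  have [x xX big] := big_closed_nbhd d0 cU0 leX UX.
  have Ux : closed_nbhds [set x] = closed_nbhd x by apply: big_set1.
  have cUx := cardsID (closed_nbhd x) U.
  (* The remainder is nonempty because [x] lies in [U] and no vertex of [U] dominates [U]. *)
  apply: (step (U :\: closed_nbhd x) [set x] 1).
  - by rewrite setD_eq0; apply: nouniv; apply: (subsetP XU).
  - by nia.
  - by rewrite Ux.
  - by rewrite cards1.
  - move=> v _; rewrite Ux; apply: subset_trans (subsetIl _ _) _.
    by apply/subsetP => y yU; rewrite in_setU in_setD yU andbT orNb.
  rewrite expn1 -cUx addnC; apply: leq_double_expn => //; lia.
have cW0 : 0 < #|W| by rewrite card_gt0.
(* Halving [#|U|] halves its [d]-th power [d] times, which pays for all of [X]. *)
apply: (step W X d) => //; first by lia.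
by rewrite -expnMn leq_exp2r.
Qed.

(** * Passage to the independence number and to logarithms *)

Lemma independence_number_induced_le (G : sgraph) (U : {set G}) (k : nat) :
  (forall S : {set G}, independent S -> S \subset U -> #|S| <= k) ->
  independence_number (induced U) <= k.
Proof.
move=> H; apply/bigmax_leqP => S indS.
rewrite -(card_imset _ val_inj); apply: H; first exact: independent_imset_val.
by apply/subsetP => _ /imsetP[x _ ->]; apply: valP.
Qed.

Import Order.TTheory GRing.Theory Num.Theory.

Lemma le_log2 (R : realType) (m n : nat) :
  2 ^ m <= n -> (m%:R <= log2 (n%:R : R))%R.
Proof.
move=> le_mn; have ln2 : (0 < ln (2 : R))%R by rewrite ln_gt0 // ltr1n.
rewrite /log2 ler_pdivlMr // mulr_natl -lnXn // -natrX ler_ln ?ler_nat //.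
  by rewrite posrE ltr0n expn_gt0.
by rewrite posrE ltr0n; apply: leq_trans le_mn; rewrite expn_gt0.
Qed.

Lemma log2X (R : realType) (n d : nat) :
  0 < n -> log2 ((n ^ d)%:R : R) = (d%:R * log2 (n%:R : R))%R.
Proof.
by move=> n0; rewrite /log2 natrX lnXn ?ltr0n // -[(ln _ *+ d)%R]mulr_natl mulrA.
Qed.

Theorem theorem1p9 (R : realType) (d : nat) (GG : graph_class)
    (hd : 2 <= d)
    (hher : hereditary GG)
    (hsep : has_dominated_balanced_separators d GG)
    (l : nat) (hl : 2 <= l)
    (G : sgraph) (hG : GG G)
    (hfree : induced_free (complete_bipartite 2 l) G)
    (hn : 2 <= #|G|) :
  exists v : G,
    ((independence_number (induced (closed_nbhd v)))%:R
       <= d%:R * l%:R * log2 (#|G|%:R : R))%R.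
Proof.
have d0 : 0 < d by lia.
have n0 : 0 < #|G| by lia.
have [|v [m [_ hm HS]]] :=
  exists_small_nbhd d0 hher hsep hG hfree (U := [set: G]).
  by rewrite -card_gt0 cardsT.
exists v; rewrite cardsT in hm.
have le_v : independence_number (induced (closed_nbhd v)) <= 1 + m * l.-1.
  by apply: independence_number_induced_le => S indS Sv; apply: HS; rewrite ?setTI.
(* This yields [1 <= L] below, so the additive [1] is absorbed:
   [1 + m * l.-1 <= L + L * l.-1 = L * l]. *)
have lt_d : 2 ^ 1 <= #|G| ^ d.
  by rewrite expn1 (leq_trans hn) // -[leqLHS]expn1 leq_pexp2l.
have := le_log2 R hm; have := le_log2 R lt_d.
rewrite log2X //; set L := (d%:R * log2 _)%R => L1 Lm.
apply: (@le_trans _ _ (1 + m * l.-1)%:R%R); first by rewrite ler_nat.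
have -> : (d%:R * l%:R * log2 (#|G|%:R : R) = L + L * l.-1%:R)%R.
  have El : l = l.-1.+1 by lia.
  by rewrite mulrAC -/L {1}El -nat1r mulrDr mulr1.
by rewrite natrD natrM; apply: lerD => //; apply: ler_wpM2r.
Qed.
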